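(* Let $F_2=\langle u,v\rangle$ be the free group on two generators. The endomorphisms $\alpha,\beta:F_2\to F_2$ defined by $$\alpha(u,v)=(u,u^{-1}v),\qquad \beta(u,v)=(vu,v)$$ are isomorphisms, with inverses defined by $$\alpha^{-1}(u,v)=(u,uv),\qquad \beta^{-1}(u,v)=(v^{-1}u,v),$$ and satisfy the braid relation $\alpha\beta\alpha=\beta\alpha\beta=:s$, where $s(u,v)=(v^u,u^{-1})$; moreover $$s^2(u,v)=(u^{-1},v^{-1})^{vu},\qquad s^4(u,v)=(u,v)^{v^{-1}u^{-1}vu}=(u,v)^{[v,u]}=\varphi_{[u,v]}(u,v).$$ Thus $\alpha,\beta$ define an injective morphism $$\Psi:B_3\to\mathrm{Aut}(F_2),\qquad \Psi(a)=\alpha,\ \Psi(b)=\beta.$$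
   Context: $B_3=\langle a,b\mid aba=bab\rangle$. For an endomorphism $x$ of $F_2$, $x(u,v)$ denotes the pair $(x(u),x(v))$, and $xy$ denotes the composition $x\circ y$. Conventions: $x^y=y^{-1}xy$, $(x,x')^y=(x^y,x'^y)$, $[x,y]=x^{-1}y^{-1}xy$, and $\varphi_x$ is the inner automorphism $y\mapsto xyx^{-1}$. *)

(* Defs.v *)
From HB Require Import structures.
From mathcomp Require Import all_boot.
From mathcomp Require Import boolp.

Set Implicit Arguments.
Unset Strict Implicit.
Unset Printing Implicit Defensive.

Local Open Scope group_scope.
Local Open Scope quotient_scope.

(* A letter (x, false) stands for the generator x, and (x, true) for x^-1. *)
Definition word (X : Type) := seq (X * bool).

Definition word_inv (X : Type) (w : word X) : word X :=
  rev [seq (l.1, ~~ l.2) | l <- w].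

(* The congruence on words generated by the free cancellations and by the
   defining relations r.1 = r.2, for r in rels. *)
Inductive word_eq (X : choiceType) (rels : seq (word X * word X)) :
  word X -> word X -> Prop :=
| WordEqRefl w : word_eq rels w w
| WordEqSym w1 w2 : word_eq rels w1 w2 -> word_eq rels w2 w1
| WordEqTrans w1 w2 w3 :
    word_eq rels w1 w2 -> word_eq rels w2 w3 -> word_eq rels w1 w3
| WordEqCat w1 w1' w2 w2' :
    word_eq rels w1 w1' -> word_eq rels w2 w2' ->
    word_eq rels (w1 ++ w2) (w1' ++ w2')
| WordEqCancel x b : word_eq rels [:: (x, b); (x, ~~ b)] [::]
| WordEqRel r : r \in rels -> word_eq rels r.1 r.2.

Section Presentation.
Variables (X : choiceType) (rels : seq (word X * word X)).

Definition word_eqb (w1 w2 : word X) : bool := `[< word_eq rels w1 w2 >].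

Lemma word_eqb_equiv : equiv_class_of word_eqb.
Proof.
split=> [w|w1 w2|w2 w1 w3]; first exact/asboolP/WordEqRefl.
  by apply/asboolP/asboolP; apply: WordEqSym.
by move=> /asboolP w12 /asboolP w23; apply/asboolP/(WordEqTrans w12 w23).
Qed.

Canonical word_eqb_equivRel := EquivRelPack word_eqb_equiv.

(* The group < X | rels > *)
Definition presented := {eq_quot word_eqb}.

HB.instance Definition _ : EqQuotient _ word_eqb presented :=
  EqQuotient.on presented.
HB.instance Definition _ := Choice.on presented.

Definition class_of_word (w : word X) : presented := \pi_presented w.

Lemma class_of_wordP w1 w2 :
  class_of_word w1 = class_of_word w2 <-> word_eq rels w1 w2.
Proof.
by split=> [/eqmodP /asboolP //| eqw]; apply/eqmodP/asboolP.
Qed.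

Lemma class_of_repr (x : presented) : class_of_word (repr x) = x.
Proof. exact: reprK. Qed.

Lemma repr_class w : word_eq rels (repr (class_of_word w)) w.
Proof. by apply/class_of_wordP; rewrite class_of_repr. Qed.

Definition presented_mul (x y : presented) := class_of_word (repr x ++ repr y).
Definition presented_one := class_of_word [::].
Definition presented_inv (x : presented) := class_of_word (word_inv (repr x)).

Lemma presented_mulE w1 w2 :
  presented_mul (class_of_word w1) (class_of_word w2) =
  class_of_word (w1 ++ w2).
Proof. by apply/class_of_wordP/WordEqCat; apply: repr_class. Qed.

Fact presented_mulA : associative presented_mul.
Proof.
move=> x y z; rewrite -(class_of_repr x) -(class_of_repr y) -(class_of_repr z).
by rewrite !presented_mulE catA.
Qed.

Fact presented_mul1 : left_id presented_one presented_mul.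
Proof. by move=> x; rewrite -(class_of_repr x) presented_mulE. Qed.

Fact presented_1mul : right_id presented_one presented_mul.
Proof. by move=> x; rewrite -(class_of_repr x) presented_mulE cats0. Qed.

Lemma word_eq_mulVw w : word_eq rels (word_inv w ++ w) [::].
Proof.
elim: w => [|[x b] w IHw]; first exact: WordEqRefl.
rewrite /word_inv /= rev_cons cat_rcons.
apply: WordEqTrans IHw; apply: WordEqCat; first exact: WordEqRefl.
rewrite -[X in word_eq _ _ X]cat0s -[_ :: _]/([:: (x, ~~ b); (x, b)] ++ w).
apply: WordEqCat (WordEqRefl _ _).
by have := WordEqCancel rels x (~~ b); rewrite negbK.
Qed.

Lemma word_eq_mulwV w : word_eq rels (w ++ word_inv w) [::].
Proof.
have wK : word_inv (word_inv w) = w.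
  rewrite /word_inv map_rev revK -map_comp -[RHS]map_id.
  by apply: eq_map => -[x b] /=; rewrite negbK.
by rewrite -[X in X ++ _]wK; apply: word_eq_mulVw.
Qed.

Fact presented_mulV : left_inverse presented_one presented_inv presented_mul.
Proof.
move=> x; rewrite -[X in presented_mul _ X]class_of_repr presented_mulE.
by apply/class_of_wordP/word_eq_mulVw.
Qed.

Fact presented_Vmul : right_inverse presented_one presented_inv presented_mul.
Proof.
move=> x; rewrite -[X in presented_mul X _]class_of_repr presented_mulE.
by apply/class_of_wordP/word_eq_mulwV.
Qed.

HB.instance Definition _ := isGroup.Build presented
  presented_mulA presented_mul1 presented_1mul presented_mulV presented_Vmul.

Definition gen (x : X) : presented := class_of_word [:: (x, false)].

Section Eval.
Variables (H : groupType) (f : X -> H).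

Definition word_eval (w : word X) : H :=
  \prod_(l <- w) (if l.2 then (f l.1)^-1 else f l.1).

(* The map sending each generator x to f x; it is a morphism as soon as f
   satisfies the relations. *)
Definition presented_eval (x : presented) : H := word_eval (repr x).

Hypothesis f_rels : forall r, r \in rels -> word_eval r.1 = word_eval r.2.

Lemma word_eval_eq w1 w2 : word_eq rels w1 w2 -> word_eval w1 = word_eval w2.
Proof.
elim=> {w1 w2} [|||w1 w1' w2 w2' _ IH1 _ IH2|x b|] //; first last.
- by rewrite /word_eval !big_cons big_nil /= mulg1; case: b;
    rewrite /= ?mulgV ?mulVg.
- by rewrite /word_eval !big_cat /= -/(word_eval _) IH1 -/(word_eval w2) IH2.
by move=> w1 w2 w3 _ ->.
Qed.

Lemma presented_evalE w : presented_eval (class_of_word w) = word_eval w.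
Proof. exact: word_eval_eq (repr_class w). Qed.

Lemma presented_eval_gen x : presented_eval (gen x) = f x.
Proof. by rewrite presented_evalE /word_eval big_seq1. Qed.

Lemma presented_evalM : {morph presented_eval : x y / x * y}.
Proof.
move=> x y; rewrite -(class_of_repr x) -(class_of_repr y).
by rewrite [_ * _]presented_mulE !presented_evalE /word_eval big_cat.
Qed.

End Eval.

Lemma class_of_wordE w : class_of_word w = word_eval gen w.
Proof.
elim: w => [|[x b] w IHw]; first by rewrite /word_eval big_nil.
rewrite /word_eval big_cons -/(word_eval gen w) -IHw /=.
rewrite -[_ :: _]/([:: (x, b)] ++ w) -presented_mulE; congr (_ * _).
case: b => //=; apply/class_of_wordP/WordEqSym.
apply/class_of_wordP; rewrite -[LHS]/((gen x)^-1).
apply: (mulgI (gen x)); rewrite mulgV; apply/esym.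
rewrite [LHS]presented_mulE; apply/class_of_wordP.
exact: WordEqCancel.
Qed.

Lemma presented_morph_ext (H : groupType)
    (f g : {multiplicative presented -> H}) :
  (forall x, f (gen x) = g (gen x)) -> f =1 g.
Proof.
have h1 (h : {multiplicative presented -> H}) : h 1 = 1.
  by apply: (mulgI (h 1)); rewrite -gmulfM !mulg1.
have hV (h : {multiplicative presented -> H}) x : h x^-1 = (h x)^-1.
  by apply: (mulgI (h x)); rewrite -gmulfM !mulgV h1.
move=> eq_fg x; rewrite -(class_of_repr x) class_of_wordE /word_eval.
rewrite (big_morph f (@gmulfM _ _ f) (h1 f)) (big_morph g (@gmulfM _ _ g) (h1 g)).
apply: eq_bigr => -[y b] _ /=.
by case: b; rewrite ?hV eq_fg.
Qed.

End Presentation.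

(* The free group on u and v, encoded by false and true *)
Definition F2 : groupType := @presented bool [::].
Definition u : F2 := gen _ false.
Definition v : F2 := gen _ true.

(* aba = bab, with a and b encoded by false and true *)
Definition braid_relation : word bool * word bool :=
  ([:: (false, false); (true, false); (false, false)],
   [:: (true, false); (false, false); (true, false)]).

Definition B3 : groupType := @presented bool [:: braid_relation].
Definition a : B3 := gen _ false.
Definition b : B3 := gen _ true.

Definition F2_end_fun (p : F2 * F2) : F2 -> F2 :=
  presented_eval (fun i : bool => if i then p.2 else p.1).

Fact F2_end_funM p : {morph F2_end_fun p : x y / x * y}.
Proof. exact: presented_evalM. Qed.

HB.instance Definition _ p :=
  isMultiplicative.Build F2 F2 (F2_end_fun p) (F2_end_funM p).

(* The endomorphism of F2 sending u to p.1 and v to p.2; see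
   map_pair_F2_end and F2_end_unique. *)
Definition F2_end (p : F2 * F2) : {multiplicative F2 -> F2} :=
  Multiplicative.clone F2 F2 (F2_end_fun p) _.

Definition map_pair (G H : Type) (f : G -> H) (p : G * G) : H * H :=
  (f p.1, f p.2).

Definition conj_pair (G : groupType) (p : G * G) (y : G) : G * G :=
  (p.1 ^ y, p.2 ^ y).

Lemma map_pair_F2_end p : map_pair (F2_end p) (u, v) = p.
Proof. by case: p => x y; rewrite /map_pair /= /F2_end_fun !presented_eval_gen. Qed.

Lemma F2_end_unique (f : {multiplicative F2 -> F2}) p :
  map_pair f (u, v) = p -> f =1 F2_end p.
Proof.
move=> <-; apply: presented_morph_ext => -[];
by rewrite /= /F2_end_fun presented_eval_gen.
Qed.

Definition inner (G : groupType) (x y : G) : G := x * y * x^-1.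

(* Automorphisms of G, with f * g the composition x |-> f (g x) *)
Section Aut.
Variable G : groupType.

Definition is_aut (f : G -> G) : bool :=
  `[< {morph f : x y / x * y} /\ bijective f >].

Record Aut := MkAut { aut_fun :> G -> G; _ : is_aut aut_fun }.

HB.instance Definition _ := [isSub for aut_fun].
HB.instance Definition _ := [Choice of Aut by <:].

Lemma autP (f : Aut) : {morph f : x y / x * y} /\ bijective f.
Proof. by case: f => f /= /asboolP. Qed.

Lemma aut_ext (f g : Aut) : f =1 g -> f = g.
Proof. by move=> eq_fg; apply/val_inj/funext. Qed.

Fact aut_mul_subproof (f g : Aut) : is_aut (f \o g).
Proof.
have [fM bij_f] := autP f; have [gM bij_g] := autP g; apply/asboolP; split.
  by move=> x y /=; rewrite gM fM.
exact: bij_comp.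
Qed.

Fact aut_one_subproof : is_aut idfun.
Proof. by apply/asboolP; split=> //; exists id. Qed.

Fact aut_inv_exists (f : Aut) : {g | is_aut g /\ cancel g f}.
Proof.
apply: cid; have [fM [g fK gK]] := autP f; exists g; split=> //.
apply/asboolP; split; last by exists f.
by move=> x y; apply: (can_inj fK); rewrite fM !gK.
Qed.

Definition aut_mul (f g : Aut) : Aut := MkAut (aut_mul_subproof f g).
Definition aut_one : Aut := MkAut aut_one_subproof.
Definition aut_inv (f : Aut) : Aut := MkAut (svalP (aut_inv_exists f)).1.

Fact aut_mulA : associative aut_mul.
Proof. by move=> f g h; apply: aut_ext. Qed.

Fact aut_mul1 : left_id aut_one aut_mul.
Proof. by move=> f; apply: aut_ext. Qed.

Fact aut_1mul : right_id aut_one aut_mul.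
Proof. by move=> f; apply: aut_ext. Qed.

Fact aut_Vmul : right_inverse aut_one aut_inv aut_mul.
Proof.
by move=> f; apply: aut_ext => x /=; apply: (svalP (aut_inv_exists f)).2.
Qed.

Fact aut_mulV : left_inverse aut_one aut_inv aut_mul.
Proof.
move=> f; apply: aut_ext => x /=; have [_ [g fK _]] := autP f.
by apply: (can_inj fK); rewrite (svalP (aut_inv_exists f)).2.
Qed.

HB.instance Definition _ := isGroup.Build Aut
  aut_mulA aut_mul1 aut_1mul aut_mulV aut_Vmul.

End Aut.

(* Main.v *)
From HB Require Import structures.
Require Import Defs.
From mathcomp Require Import all_boot.
From mathcomp Require Import order ssralg ssrnum ssrint zify boolp.

Set Implicit Arguments.
Unset Strict Implicit.
Unset Printing Implicit Defensive.

Local Open Scope group_scope.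

(** Everything except the injectivity of [Psi] is a computation on the
generators [u] and [v].

For injectivity, put [Delta = aba] and [y = ab].  In [B3] one has
[Delta^2 = y^3], and this element is central; [B3] is generated by [Delta]
and [y].  Modulo the powers of [Delta^2], [B3] is therefore a quotient of the
free product of a group of order 2 and a group of order 3, so that every
element is, up to such a power, of the form [y^e W Delta^d] with [e < 3], [d < 2] and [W]
a product of syllables [Delta y] and [Delta y^2] ([B3_normal_form]).

An automorphism [f] of [F2] acts on the characters of [F2] by precomposition.
The character sending [(u, v)] to [(m, n)] is identified with [(m, n)] in
[Z^2]; then [Delta] acts as [(m, n) |-> (n, -m)] and [y] as
[(m, n) |-> (n, n - m)], so that [Delta^2] acts as [-1].  Up to sign, the two
syllables act as [(m, n) |-> (m, m + n)] and [(m, n) |-> (m + n, n)]: they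
preserve the set of points with coordinates of the same strict sign, and they
increase [|m| + |n|] on it.  If [Psi g = 1], then the normal form of [g]
fixes every point of [Z^2] up to sign; well-chosen points force [d = 0], [e = 0] and [W = 1] ([kernel_power_Delta2]).  So [g] is a power of
[Delta^2].

Finally [Psi] sends [Delta^4] to conjugation by the commutator of [v] and [u],
and distinct powers of this commutator conjugate [u] to distinct elements, as
can be seen in the infinite dihedral group
([commutator_powers_act_freely]).  Hence [g = 1]. *)

(** * Morphisms of groups and presentations *)

Lemma presented_ind (X : choiceType) (rels : seq (word X * word X))
    (P : presented rels -> Prop) :
  P 1 ->
  (forall g i, P g -> P (g * gen rels i)) ->
  (forall g i, P g -> P (g * (gen rels i)^-1)) ->
  forall g, P g.
Proof.
move=> P1 PM PMV g; rewrite -(class_of_repr g).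
elim/last_ind: (repr g) => [|w [i e] IHw] //.
rewrite -cats1 -presented_mulE -/(_ * _) (class_of_wordE rels [:: _]).
by rewrite /word_eval big_seq1; case: e => /=; [apply: PMV | apply: PM].
Qed.

(** Between groups, a map that preserves products is a morphism of groups. *)
Section MultiplicativeTheory.
Variables (G H : groupType) (f : {multiplicative G -> H}).

Lemma multiplicative1 : f 1 = 1.
Proof. by apply: (mulgI (f 1)); rewrite -gmulfM !mulg1. Qed.

Lemma multiplicativeV : {morph f : x / x^-1}.
Proof.
by move=> x; apply: (mulgI (f x)); rewrite -gmulfM !mulgV multiplicative1.
Qed.

Lemma multiplicativeJ : {morph f : x y / x ^ y}.
Proof. by move=> x y; rewrite !gmulfM multiplicativeV. Qed.

Lemma multiplicativeX n : {morph f : x / x ^+ n}.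
Proof.
by elim: n => [|n IHn] x; rewrite ?multiplicative1 // !expgS gmulfM IHn.
Qed.

End MultiplicativeTheory.

Lemma F2_ext (H : groupType) (f g : {multiplicative F2 -> H}) :
  f u = g u -> f v = g v -> f =1 g.
Proof. by move=> fu fv; apply: presented_morph_ext => -[]. Qed.

Section F2Eval.
Variables (H : groupType) (p : H * H).

Definition F2_eval : F2 -> H :=
  presented_eval (fun i : bool => if i then p.2 else p.1).

Fact F2_evalM : {morph F2_eval : x y / x * y}.
Proof. exact: presented_evalM. Qed.

HB.instance Definition _ := isMultiplicative.Build F2 H F2_eval F2_evalM.

Lemma F2_eval_u : F2_eval u = p.1.
Proof. exact: presented_eval_gen. Qed.

Lemma F2_eval_v : F2_eval v = p.2.
Proof. exact: presented_eval_gen. Qed.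

End F2Eval.

(** * The automorphisms alpha, beta and s *)

Lemma F2_end_u x y : F2_end_fun (x, y) u = x.
Proof. exact: (F2_eval_u (x, y)). Qed.

Lemma F2_end_v x y : F2_end_fun (x, y) v = y.
Proof. exact: (F2_eval_v (x, y)). Qed.

Lemma F2_endV p x : F2_end_fun p x^-1 = (F2_end_fun p x)^-1.
Proof. exact: (multiplicativeV (F2_end p)). Qed.

Definition F2_endE := (F2_end_u, F2_end_v, F2_end_funM, F2_endV).

Ltac free_reduce := rewrite ?conjgE ?gnorm.

Local Notation alpha := (F2_end (u, u^-1 * v)).
Local Notation beta := (F2_end (v * u, v)).
Local Notation alphaV := (F2_end (u, u * v)).
Local Notation betaV := (F2_end (v^-1 * u, v)).

Definition s : {multiplicative F2 -> F2} :=
  Multiplicative.clone F2 F2 (alpha \o beta \o alpha) _.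

Lemma alphaK : cancel alpha alphaV.
Proof.
by apply: (@F2_ext F2 (alphaV \o alpha) idfun); rewrite /= !F2_endE ?mulKg.
Qed.

Lemma alphaVK : cancel alphaV alpha.
Proof.
by apply: (@F2_ext F2 (alpha \o alphaV) idfun); rewrite /= !F2_endE ?mulVKg.
Qed.

Lemma betaK : cancel beta betaV.
Proof.
by apply: (@F2_ext F2 (betaV \o beta) idfun); rewrite /= !F2_endE ?mulVKg.
Qed.

Lemma betaVK : cancel betaV beta.
Proof.
by apply: (@F2_ext F2 (beta \o betaV) idfun); rewrite /= !F2_endE ?mulKg.
Qed.

Lemma s_u : s u = v ^ u.
Proof. by rewrite -[s u]/(alpha (beta (alpha u))) /= !F2_endE; free_reduce. Qed.

Lemma s_v : s v = u^-1.
Proof. by rewrite -[s v]/(alpha (beta (alpha v))) /= !F2_endE; free_reduce. Qed.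

Lemma alpha_beta_braid : alpha \o beta \o alpha =1 beta \o alpha \o beta.
Proof.
by apply: (@F2_ext F2 (alpha \o beta \o alpha) (beta \o alpha \o beta));
  rewrite /= !F2_endE; free_reduce.
Qed.

Lemma s2_u : s (s u) = u^-1 ^ (v * u).
Proof. by rewrite s_u multiplicativeJ s_u s_v; free_reduce. Qed.

Lemma s2_v : s (s v) = v^-1 ^ (v * u).
Proof. by rewrite s_v multiplicativeV s_u; free_reduce. Qed.

Lemma innerE (G : groupType) (x y : G) : inner x y = y ^ x^-1.
Proof. by rewrite /inner conjgE invgK mulgA. Qed.

Fact innerM (G : groupType) (x : G) : {morph inner x : y z / y * z}.
Proof. by move=> y z; rewrite !innerE conjMg. Qed.

HB.instance Definition _ (G : groupType) (x : G) :=
  isMultiplicative.Build G G (inner x) (@innerM G x).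

(** By [s2_u] and [s2_v], [s^2] inverts the generators and conjugates by [v * u].
Hence [s^4] conjugates by [v * u] times the image of [v * u] under [s^2], which
reduces to the commutator. *)
Lemma s4E w : s (s (s (s w))) = w ^ [~ v, u].
Proof.
rewrite -(invgR u v) -innerE.
apply: (@F2_ext F2 (s \o s \o s \o s) (inner [~ u, v])).
  rewrite -[RHS]/(inner _ u) innerE invgR -[LHS]/(s (s (s (s u)))) s2_u.
  rewrite !(multiplicativeJ, gmulfM, multiplicativeV) s2_u s2_v commgEl.
  by free_reduce.
rewrite -[RHS]/(inner _ v) innerE invgR -[LHS]/(s (s (s (s v)))) s2_v.
rewrite !(multiplicativeJ, gmulfM, multiplicativeV) s2_u s2_v commgEl.
by free_reduce.
Qed.

(** * The infinite dihedral group and the characters of F2 *)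

(** The isometries [x |-> m + x] and [x |-> m - x] of [Z], encoded by
[(false, m)] and [(true, m)].  The translations serve as a multiplicative copy
of [Z]; the reflections are used in [commutator_powers_act_freely]. *)
Definition Dinf : Type := (bool * int)%type.
HB.instance Definition _ := Choice.on Dinf.

Definition Dinf_mul (g h : Dinf) : Dinf :=
  (g.1 (+) h.1, (g.2 + (if g.1 then - h.2 else h.2))%R).
Definition Dinf_inv (g : Dinf) : Dinf :=
  (g.1, if g.1 then g.2 else (- g.2)%R).

Fact Dinf_mulA : associative Dinf_mul.
Proof. by move=> [[] m] [[] n] [[] k]; rewrite /Dinf_mul /=; congr pair; lia. Qed.

Fact Dinf_mul1 : left_id (false, 0%R) Dinf_mul.
Proof. by move=> [e m]; rewrite /Dinf_mul /=; congr pair; lia. Qed.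

Fact Dinf_1mul : right_id (false, 0%R) Dinf_mul.
Proof. by move=> [[] m]; rewrite /Dinf_mul /=; congr pair; lia. Qed.

Fact Dinf_mulV : left_inverse (false, 0%R) Dinf_inv Dinf_mul.
Proof. by move=> [[] m]; rewrite /Dinf_mul /=; congr pair; lia. Qed.

Fact Dinf_Vmul : right_inverse (false, 0%R) Dinf_inv Dinf_mul.
Proof. by move=> [[] m]; rewrite /Dinf_mul /=; congr pair; lia. Qed.

HB.instance Definition _ := isGroup.Build Dinf
  Dinf_mulA Dinf_mul1 Dinf_1mul Dinf_mulV Dinf_Vmul.

Definition translation (m : int) : Dinf := (false, m).

Lemma translation_inj : injective translation.
Proof. by move=> m n []. Qed.

Lemma translationM m n : translation m * translation n = translation (m + n)%R.
Proof. by []. Qed.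

Lemma translationV m : (translation m)^-1 = translation (- m)%R.
Proof. by []. Qed.

Lemma translationX m k : translation m ^+ k = translation (m * k%:Z)%R.
Proof.
elim: k => [|k IHk]; first by rewrite GRing.mulr0.
by rewrite expgS IHk translationM intS GRing.mulrDr GRing.mulr1.
Qed.

Definition character (z : int * int) : F2 -> Dinf :=
  F2_eval (translation z.1, translation z.2).
HB.instance Definition _ z := Multiplicative.on (character z).

Lemma characterM z : {morph character z : x y / x * y}.
Proof. exact: gmulfM. Qed.

Lemma characterV z : {morph character z : x / x^-1}.
Proof. exact: (multiplicativeV (F2_eval _)). Qed.

Lemma character_u z : character z u = translation z.1.
Proof. exact: F2_eval_u. Qed.

Lemma character_v z : character z v = translation z.2.
Proof. exact: F2_eval_v. Qed.

Lemma character_inj z z' : character z =1 character z' -> z = z'.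
Proof.
move=> eq_zz'; have := eq_zz' u; have := eq_zz' v.
rewrite !character_u !character_v => /translation_inj + /translation_inj.
by case: z z' {eq_zz'} => [? ?] [? ?] /= -> ->.
Qed.

(** * The representation of B3 *)

Definition Aut_of_can (G : groupType) (f fV : {multiplicative G -> G})
  (fK : cancel f fV) (fVK : cancel fV f) : Aut G :=
  MkAut (asboolT (conj (@gmulfM _ _ f) (Bijective fK fVK))).

Definition Psi_gen (i : bool) : Aut F2 :=
  if i then Aut_of_can betaK betaVK else Aut_of_can alphaK alphaVK.

Fact Psi_gen_rels r : r \in [:: braid_relation] ->
  word_eval Psi_gen r.1 = word_eval Psi_gen r.2.
Proof.
rewrite inE => /eqP ->; rewrite /word_eval !big_cons !big_nil /= !mulg1.
exact/aut_ext/alpha_beta_braid.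
Qed.

Definition Psi_fun : B3 -> Aut F2 := presented_eval Psi_gen.

HB.instance Definition _ :=
  isMultiplicative.Build B3 (Aut F2) Psi_fun (presented_evalM Psi_gen_rels).

Definition Psi : {multiplicative B3 -> Aut F2} :=
  Multiplicative.clone B3 (Aut F2) Psi_fun _.

Lemma Psi_a : Psi a =1 alpha.
Proof. by move=> w; rewrite /= /Psi_fun (presented_eval_gen Psi_gen_rels). Qed.

Lemma Psi_b : Psi b =1 beta.
Proof. by move=> w; rewrite /= /Psi_fun (presented_eval_gen Psi_gen_rels). Qed.

Lemma PsiM g h w : Psi (g * h) w = Psi g (Psi h w).
Proof. by rewrite gmulfM. Qed.

(** * A normal form modulo the centre *)

(** If [x^2 = y^3 = z] is central, then modulo powers of [z] every element of the
subgroup generated by [x] and [y] is an alternating product of [x] and of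
[y] or [y^2].  Grouping each [x] with the power of [y] that follows it leaves a
power of [y] on the left and possibly an [x] on the right. *)
Section NormalForm.
Variables (G : groupType) (x y z : G).
Hypotheses (x2 : x ^+ 2 = z) (y3 : y ^+ 3 = z) (z_central : forall g, commute z g).

Definition syllable (l : bool) : G := if l then x * y * y else x * y.

Definition syllables (L : seq bool) : G := \prod_(l <- L) syllable l.

Lemma syllables_rcons L l : syllables (rcons L l) = syllables L * syllable l.
Proof. by rewrite /syllables -cats1 big_cat big_seq1. Qed.

(** Powers of [z] appear on both sides because exponents are natural numbers. *)
Definition has_normal_form (g : G) : Prop :=
  exists p q e L (d : bool),
    e < 3 /\ z ^+ p * g = z ^+ q * (y ^+ e * syllables L * x ^+ d).

Lemma has_normal_form1 : has_normal_form 1.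
Proof. by exists 0, 0, 0, [::], false; rewrite /syllables big_nil !mulg1. Qed.

Lemma central_right q h : z ^+ q * (h * z) = z ^+ q.+1 * h.
Proof. by rewrite -z_central mulgA -expgSr. Qed.

Lemma has_normal_form_mulx g : has_normal_form g -> has_normal_form (g * x).
Proof.
move=> [p [q [e [L [[] [lt_e3 gE]]]]]]; last first.
  by exists p, q, e, L, true; rewrite mulgA gE mulg1 !mulgA.
exists p, q.+1, e, L, false; split=> //.
by rewrite mulgA gE -central_right mulg1 -x2 -!mulgA.
Qed.

(** A factor [y] turns a final [x] into a syllable [xy], a final syllable [xy]
into [xyy], and a final syllable [xyy] into [xz]. *)
Lemma has_normal_form_muly g : has_normal_form g -> has_normal_form (g * y).
Proof.
move=> [p [q [e [L [[] [lt_e3 gE]]]]]].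
  exists p, q, e, (rcons L false), false; split=> //.
  by rewrite mulgA gE mulg1 syllables_rcons /= !mulgA.
case/lastP: L gE => [|L []]; rewrite ?syllables_rcons /= mulg1 => gE.
- move: gE; rewrite /syllables big_nil mulg1 => gE.
  have [e2 | ne_e2] := eqVneq e 2.
    exists p, q.+1, 0, [::], false; split=> //.
    by rewrite mulgA gE e2 /syllables big_nil !mulg1 -mulgA -expgSr y3 -expgSr.
  exists p, q, e.+1, [::], false; split; first by lia.
  by rewrite mulgA gE /syllables big_nil !mulg1 expgSr mulgA.
- exists p, q.+1, e, L, true; split=> //.
  by rewrite mulgA gE -central_right -y3 -!mulgA.
exists p, q, e, (rcons L true), false; split=> //.
by rewrite mulgA gE mulg1 syllables_rcons /= !mulgA.
Qed.

Lemma has_normal_form_mulz g : has_normal_form (g * z) -> has_normal_form g.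
Proof.
move=> [p [q [e [L [d [lt_e3 gE]]]]]]; exists p.+1, q, e, L, d.
by rewrite -gE central_right.
Qed.

(** Modulo [z], the inverse of [x] is [x] and the inverse of [y] is [y * y]. *)
Lemma has_normal_form_mulxV g : has_normal_form g -> has_normal_form (g * x^-1).
Proof.
move=> nf_g; apply: has_normal_form_mulz.
by rewrite -x2 mulgA mulgVK; apply: has_normal_form_mulx.
Qed.

Lemma has_normal_form_mulyV g : has_normal_form g -> has_normal_form (g * y^-1).
Proof.
move=> nf_g; apply: has_normal_form_mulz.
by rewrite -y3 mulgA mulgVK mulgA; do 2!apply: has_normal_form_muly.
Qed.

End NormalForm.

Definition Delta : B3 := a * b * a.

Lemma DeltaE : Delta = b * a * b.
Proof.
rewrite /Delta [LHS](_ : _ = word_eval (gen [:: braid_relation]) braid_relation.1).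
  rewrite [RHS](_ : _ = word_eval (gen [:: braid_relation]) braid_relation.2).
    rewrite -!class_of_wordE; apply/class_of_wordP; apply: WordEqRel.
    by rewrite inE.
  by rewrite /word_eval !big_cons big_nil /= mulg1 mulgA.
by rewrite /word_eval !big_cons big_nil /= mulg1 mulgA.
Qed.

(** The six letters of [(ab)^3] are those of [(aba)(bab)]. *)
Lemma ab3 : (a * b) ^+ 3 = Delta ^+ 2.
Proof.
rewrite -[RHS]/(Delta * Delta) {2}DeltaE /Delta -[LHS]/(a * b * (a * b * (a * b))).
by rewrite !mulgA.
Qed.

Lemma aE : a = (a * b)^-1 * Delta.
Proof. by rewrite /Delta mulKg. Qed.

Lemma bE : b = Delta * (a * b)^-1.
Proof. by rewrite DeltaE -(mulgA b) mulgK. Qed.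

Lemma Delta2_central g : commute (Delta ^+ 2) g.
Proof.
have cD : commute (Delta ^+ 2) Delta by apply/commute_sym/commuteX.
have cab : commute (Delta ^+ 2) (a * b).
  by rewrite -ab3; apply/commute_sym/commuteX.
have ca : commute (Delta ^+ 2) a.
  by rewrite aE; apply: commuteM => //; apply: commuteV.
have cb : commute (Delta ^+ 2) b.
  by rewrite bE; apply: commuteM => //; apply: commuteV.
have cgen i : commute (Delta ^+ 2) (gen _ i) by case: i.
elim/(@presented_ind bool [:: braid_relation]): g => [|h i ch|h i ch].
- exact: commute1.
- exact: commuteM.
by apply: commuteM => //; apply: commuteV.
Qed.

Lemma B3_normal_form g : has_normal_form Delta (a * b) (Delta ^+ 2) g.
Proof.
have nfX := has_normal_form_mulx (erefl (Delta ^+ 2)) Delta2_central.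
have nfXV := has_normal_form_mulxV (erefl (Delta ^+ 2)) Delta2_central.
have nfY := has_normal_form_muly ab3 Delta2_central.
have nfYV := has_normal_form_mulyV ab3 Delta2_central.
elim/(@presented_ind bool [:: braid_relation]): g => [|h [] nf_h|h [] nf_h].
- exact: has_normal_form1.
- suff -> : h * gen _ true = h * Delta * (a * b)^-1 by apply: nfYV; apply: nfX.
  by rewrite -mulgA -bE.
- suff -> : h * gen _ false = h * (a * b)^-1 * Delta by apply: nfX; apply: nfYV.
  by rewrite -mulgA -aE.
- suff -> : h * (gen _ true)^-1 = h * (a * b) * Delta^-1.
    by apply: nfXV; apply: nfY.
  by rewrite -/b [in LHS]bE invgF mulgA.
suff -> : h * (gen _ false)^-1 = h * Delta^-1 * (a * b).
  by apply: nfY; apply: nfXV.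
by rewrite -/a [in LHS]aE invgM invgK mulgA.
Qed.

(** * Ping-pong on the plane of characters *)

(** Precomposition with [Psi g] takes the character [z] to the character [z'].
This is a right action of [B3], whence the order of the factors in [actsM]. *)
Definition acts (g : B3) (z z' : int * int) : Prop :=
  forall w, character z (Psi g w) = character z' w.

Lemma acts1 z : acts 1 z z.
Proof. by move=> w; rewrite multiplicative1. Qed.

Lemma actsM g h z z' z'' : acts g z z' -> acts h z' z'' -> acts (g * h) z z''.
Proof. by move=> gz hz w; rewrite PsiM gz hz. Qed.

Lemma acts_inj g z z' z'' : acts g z z' -> acts g z z'' -> z' = z''.
Proof. by move=> gz gz'; apply: character_inj => w; rewrite -gz gz'. Qed.

Lemma acts_iter g f k z : (forall z, acts g z (f z)) -> acts (g ^+ k) z (iter k f z).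
Proof.
move=> gf; elim: k => [|k IHk]; first exact: acts1.
by rewrite expgSr iterS; apply: actsM (gf _).
Qed.

Lemma acts_a m n : acts a (m, n) (m, n - m)%R.
Proof.
move=> w; rewrite Psi_a.
move: w; apply: (@F2_ext Dinf (character (m, n) \o alpha) (character (m, n - m)%R)).
  by rewrite /= F2_endE !character_u.
rewrite -[LHS]/(character (m, n) (alpha v)) /= F2_endE characterM characterV.
by rewrite !character_u !character_v translationV translationM GRing.addrC.
Qed.

Lemma acts_b m n : acts b (m, n) (m + n, n)%R.
Proof.
move=> w; rewrite Psi_b.
move: w; apply: (@F2_ext Dinf (character (m, n) \o beta) (character (m + n, n)%R)).
  rewrite -[LHS]/(character (m, n) (beta u)) /= F2_endE characterM.
  by rewrite !character_u character_v translationM GRing.addrC.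
by rewrite /= F2_endE !character_v.
Qed.

(** Linear maps of orders 4 and 6, by which [Delta] and [a * b] act. *)
Definition turn4 (z : int * int) : int * int := (z.2, - z.1)%R.
Definition turn6 (z : int * int) : int * int := (z.2, z.2 - z.1)%R.

Lemma acts_ab z : acts (a * b) z (turn6 z).
Proof.
case: z => m n; have := actsM (acts_a m n) (acts_b m (n - m)%R).
by rewrite [(m + _)%R]GRing.addrC GRing.subrK.
Qed.

Lemma acts_Delta z : acts Delta z (turn4 z).
Proof.
have := actsM (acts_ab z) (acts_a _ _); rewrite /turn4 /=.
by congr acts; congr pair; lia.
Qed.

Definition eq_up_to_sign (z z' : int * int) : Prop :=
  z' = z \/ z' = (- z.1, - z.2)%R.

Definition same_sign (z : int * int) : bool :=
  ((0 < z.1) && (0 < z.2) || (z.1 < 0) && (z.2 < 0))%R.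

Definition height (z : int * int) : nat := (absz z.1 + absz z.2)%N.

Lemma eq_up_to_sign_eucl z z' z'' :
  eq_up_to_sign z z' -> eq_up_to_sign z z'' -> eq_up_to_sign z' z''.
Proof.
rewrite /eq_up_to_sign; case: z => m n [] -> [] -> /=; rewrite ?GRing.opprK;
  by [left | right].
Qed.

Lemma eq_up_to_sign_iter k z : eq_up_to_sign z (iter k (iter 2 turn4) z).
Proof.
elim: k => [|k]; first by left.
rewrite iterS => -[] ->; [right | left] => //.
by rewrite /turn4 /= !GRing.opprK; case: z.
Qed.

(** Up to sign, each syllable adds one coordinate to the other: points of the open
quadrants where both coordinates have the same sign stay there, and move away
from the origin. *)
Lemma acts_syllables L z : same_sign z ->
  exists z', [/\ acts (syllables Delta (a * b) L) z z',
    same_sign z' & size L + height z <= height z'].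
Proof.
elim: L z => [|l L IHL] z pos_z.
  by exists z; split=> //; rewrite /syllables big_nil; apply: acts1.
pose z1 := if l then turn6 (turn6 (turn4 z)) else turn6 (turn4 z).
have act_l : acts (syllable Delta (a * b) l) z z1.
  have act_xy := actsM (acts_Delta z) (acts_ab _).
  by rewrite /z1; case: l {z1}; [apply: actsM act_xy (acts_ab _) | apply: act_xy].
have [pos_z1 lt_z] : same_sign z1 /\ height z < height z1.
  rewrite /z1 /turn4 /turn6; case: z pos_z {act_l z1} => m n.
  by rewrite /same_sign /height /=; case: l => /= pos_z; split; lia.
have [z' [act_L pos_z' le_z']] := IHL z1 pos_z1; exists z'; split=> //.
  by rewrite /syllables big_cons; apply: actsM act_l act_L.
by rewrite /=; lia.
Qed.

(** The normal form [y^e W Delta^d] of an element of the kernel fixes every point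
up to sign.  If [y^e] moves a point into the open quadrants of equal signs,
then [W] keeps it there, and [Delta] takes it out.  So no such point lies in
these quadrants if [d = 1], or outside them if [d = 0].  Such a point exists
unless [d = e = 0], and then the growth of [height] along the orbit of [(1, 1)]
shows that [W] is empty. *)
Lemma kernel_power_Delta2 g : Psi g = 1 ->
  exists p q, (Delta ^+ 2) ^+ p * g = (Delta ^+ 2) ^+ q.
Proof.
move=> Psi_g; have [p [q [e [L [d [lt_e3 gE]]]]]] := B3_normal_form g.
have actD2 k z := @acts_iter _ _ k z (fun z => acts_iter 2 z acts_Delta).
have fix_point z : exists2 z0, eq_up_to_sign z z0 &
    forall z1, acts (syllables Delta (a * b) L) (iter e turn6 z0) z1 ->
    eq_up_to_sign z0 (iter d turn4 z1).
  exists (iter q (iter 2 turn4) z); first exact: eq_up_to_sign_iter.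
  move=> z1 act_L.
  have act_r := actsM (actD2 q z)
    (actsM (actsM (acts_iter e _ acts_ab) act_L) (acts_iter d _ acts_Delta)).
  have act_l : acts ((Delta ^+ 2) ^+ p * g) z (iter p (iter 2 turn4) z).
    by apply: actsM (actD2 p z) _ => w; rewrite Psi_g.
  rewrite -gE in act_r; rewrite (acts_inj act_r act_l).
  exact: eq_up_to_sign_eucl (eq_up_to_sign_iter q z) (eq_up_to_sign_iter p z).
have no_fix z : (forall z0, eq_up_to_sign z z0 ->
     same_sign (iter e turn6 z0) /\ same_sign z0 = d) -> False.
  move=> bad; have [z0 z_z0 fix_z0] := fix_point z.
  have [pos_z0 z0_d] := bad z0 z_z0.
  have [z1 [act_L pos_z1 _]] := acts_syllables L pos_z0.
  have := fix_z0 z1 act_L.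
  clear -z0_d pos_z1; case: z0 z0_d => m n; case: z1 pos_z1 => m1 n1.
  rewrite /same_sign /eq_up_to_sign /turn4.
  by case: d => /= pos_z1 z0_d [] [] *; lia.
exists p, q; rewrite gE.
(* turn6 takes (1, 2) to (2, 1), and its square takes (2, 1) to (-1, -2): these
   points lie in the quadrants of equal signs before and after y^e. *)
have /negbTE d_false : ~~ d.
  apply/negP => d_true; apply: (no_fix (if e is 0 then (1, 1) else
    if e is 1 then (1, 2) else (2, 1))%R) => z0; rewrite d_true.
  by case: e lt_e3 {gE fix_point no_fix} => [|[|[]]] // _ [] ->.
(* The point (-1, 1) is outside these quadrants; turn6 and its square take
   (-1, 1) to (1, 2) and (2, 1). *)
have e0 : e = 0.
  apply/eqP/negPn/negP => e_n0; apply: (no_fix (-1, 1)%R) => z0; rewrite d_false.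
  by case: e lt_e3 e_n0 {gE fix_point no_fix} => [|[|[]]] // _ _ [] ->.
have [z0 z_z0 fix_z0] := fix_point (1, 1)%R.
have pos_z0 : same_sign z0 by case: z_z0 => ->.
have [z1 [act_L _ le_z1]] := acts_syllables L pos_z0.
rewrite e0 d_false /= in fix_z0.
have : height z1 = height z0.
  by case: (fix_z0 z1 act_L) => ->; rewrite /height //= !abszN.
move=> eq_z1; have /nilP -> : nilp L by rewrite /nilp; lia.
by rewrite e0 d_false /syllables big_nil !mulg1.
Qed.

Lemma Psi_Delta w : Psi Delta w = s w.
Proof. by rewrite !PsiM !Psi_a Psi_b. Qed.

Lemma Psi_Delta4 k w : Psi ((Delta ^+ 2) ^+ k ^+ 2) w = w ^ ([~ v, u] ^+ k).
Proof.
rewrite expgnAC.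
elim: k => [|k IHk]; first by rewrite multiplicative1 conjg1.
rewrite expgS PsiM IHk (PsiM (Delta * Delta)) !(PsiM Delta) !Psi_Delta s4E -conjgM.
by rewrite -expgSr.
Qed.

(** Send [u] to the reflection [x |-> -x] and [v] to the translation by 1.  The
commutator becomes a nontrivial translation, and conjugating a reflection by
distinct translations gives distinct reflections. *)
Lemma commutator_powers_act_freely p q :
  u ^ ([~ v, u] ^+ p) = u ^ ([~ v, u] ^+ q) -> p = q.
Proof.
pose dih : {multiplicative F2 -> Dinf} :=
  Multiplicative.clone F2 Dinf (F2_eval ((true, 0%R) : Dinf, translation 1)) _.
have dih_u : dih u = (true, 0%R) by apply: F2_eval_u.
have dih_v : dih v = translation 1 by apply: F2_eval_v.
have dih_c : dih [~ v, u] = translation (-2)%R.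
  by rewrite commgEl !(multiplicativeJ, multiplicativeV, gmulfM) dih_u dih_v.
have dih_pow k : dih (u ^ ([~ v, u] ^+ k)) = (true, (4 * k%:Z)%R).
  rewrite multiplicativeJ multiplicativeX dih_c dih_u translationX.
  rewrite conjgE translationV; congr pair => /=; lia.
move=> /(congr1 dih); rewrite !dih_pow => -[]; lia.
Qed.

(** An element of the kernel satisfies [Delta^(2p) g = Delta^(2q)]; since
conjugations are known for [Delta^4] only, the equality of the images of
[Delta^(2p)] and [Delta^(2q)] is squared before it is used. *)
Lemma Psi_inj : injective Psi.
Proof.
have ker g : Psi g = 1 -> g = 1.
  move=> Psi_g; have [p [q gE]] := kernel_power_Delta2 Psi_g.
  have Psi_pq : Psi ((Delta ^+ 2) ^+ p) = Psi ((Delta ^+ 2) ^+ q).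
    by rewrite -gE gmulfM Psi_g mulg1.
  have pq : p = q.
    apply: commutator_powers_act_freely; rewrite -!Psi_Delta4.
    by rewrite !(multiplicativeX _ 2) Psi_pq.
  by apply: (mulgI ((Delta ^+ 2) ^+ p)); rewrite gE pq mulg1.
move=> g h eq_gh; apply/divg1_eq/ker.
by rewrite gmulfM multiplicativeV eq_gh mulgV.
Qed.

Theorem mainTheorem5 :
  let alpha := F2_end (u, u^-1 * v) in
  let beta := F2_end (v * u, v) in
  let alphaV := F2_end (u, u * v) in
  let betaV := F2_end (v^-1 * u, v) in
  let s := alpha \o beta \o alpha in
  [/\ bijective alpha /\ bijective beta,
      [/\ cancel alpha alphaV, cancel alphaV alpha,
          cancel beta betaV & cancel betaV beta],
      alpha \o beta \o alpha =1 beta \o alpha \o beta,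
      [/\ map_pair s (u, v) = (v ^ u, u^-1),
          map_pair (iter 2 s) (u, v) = conj_pair (u^-1, v^-1) (v * u),
          map_pair (iter 4 s) (u, v) = conj_pair (u, v) (v^-1 * u^-1 * v * u),
          conj_pair (u, v) (v^-1 * u^-1 * v * u) = conj_pair (u, v) [~ v, u]
        & conj_pair (u, v) [~ v, u] = map_pair (inner [~ u, v]) (u, v)]
    & exists Psi : {multiplicative B3 -> Aut F2},
        [/\ Psi a =1 alpha, Psi b =1 beta, injective Psi
          & forall Psi' : {multiplicative B3 -> Aut F2},
              Psi' a =1 alpha -> Psi' b =1 beta -> Psi' =1 Psi]].
Proof.
have commE : v^-1 * u^-1 * v * u = [~ v, u] :> F2.
  by rewrite commgEl conjgE !mulgA.
move=> alpha beta alphaV betaV s'; split.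
- by split; [exists alphaV; [exact: alphaK | exact: alphaVK]
            | exists betaV; [exact: betaK | exact: betaVK]].
- by split; [exact: alphaK | exact: alphaVK | exact: betaK | exact: betaVK].
- exact: alpha_beta_braid.
- split.
  + by congr pair; [exact: s_u | exact: s_v].
  + by congr pair; [exact: s2_u | exact: s2_v].
  + by rewrite commE; congr pair; exact: s4E.
  + by rewrite commE.
  + by rewrite /map_pair /= !innerE invgR.
exists Psi; split; [exact: Psi_a | exact: Psi_b | exact: Psi_inj | ].
move=> Psi' Psi'_a Psi'_b; apply: presented_morph_ext => -[]; apply: aut_ext => w.
  by rewrite -/b Psi'_b Psi_b.
by rewrite -/a Psi'_a Psi_a.
Qed.
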